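(* Let $G$ be an outerplanar graph with maximum degree $\Delta$. Then: (1) if $\Delta<5$, then $\chi'_{gl}(G)\leq \Delta+1$; (2) if $\Delta\geq 5$, then $\chi'_{gl}(G)\leq \Delta$.
   Context: All graphs are finite and simple. A planar graph is outerplanar if it has a drawing in the plane in which each vertex lies on the boundary of the outer face. $\ell(G)$ denotes the line graph of $G$ (its vertices are the edges of $G$, two being adjacent iff they share an endpoint in $G$). Let $H$ be a graph with a fixed orientation of its edges, $A$ an Abelian group, $L:V(H)\to 2^A$ a list assignment and $f:E(H)\to A$. An $(A,L,f)$-coloring of $H$ is a map $c:V(H)\to A$ with $c(v)\in L(v)$ for every vertex $v$ and $c(x)-c(y)\neq f(xy)$ for every edge $xy$ directed from $x$ to $y$. $H$ is $(A,L)$-colorable if it has an $(A,L,f)$-coloring for every $f:E(H)\to A$ (this does not depend on the orientation). $H$ is $k$-group choosable if it is $(A,L)$-colorable for every Abelian group $A$ of order at least $k$ and every $L$ with $|L(v)|=k$ for all $v\in V(H)$. $\chi_{gl}(H)$ is the smallest $k$ such that $H$ is $k$-group choosable. $\chi'_{gl}(G)=\chi_{gl}(\ell(G))$. *)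

(* Defs.v *)
From mathcomp Require Import all_boot all_order all_algebra.
From mathcomp Require Import finmap.
From mathcomp Require Import all_classical all_reals all_analysis.
Set Implicit Arguments.
Unset Strict Implicit.
Unset Printing Implicit Defensive.
Import Order.TTheory GRing.Theory Num.Theory.
Import numFieldNormedType.Exports.

Record sgraph := SGraph {
  svertex :> finType;
  sadj : rel svertex;
  sadj_sym : symmetric sadj;
  sadj_irr : irreflexive sadj }.

Definition edges (G : sgraph) : {set {set G}} :=
  [set e : {set G} | [exists x, exists y, sadj x y && (e == [set x; y])]].

Definition edge (G : sgraph) := {e : {set G} | e \in edges G}.

Definition degree (G : sgraph) (x : G) : nat := #|[set y | sadj x y]|.

Definition max_degree (G : sgraph) : nat := \max_(x : G) degree x.

Section LineGraph.
Variable G : sgraph.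

Definition line_adj : rel (edge G) :=
  [rel e e' | (e != e') && (val e :&: val e' != finset.set0)].

Lemma line_adj_sym : symmetric line_adj.
Proof. by move=> e e'; rewrite /line_adj /= eq_sym finset.setIC. Qed.

Lemma line_adj_irr : irreflexive line_adj.
Proof. by move=> e; rewrite /line_adj /= eqxx. Qed.

Definition line_graph : sgraph := SGraph line_adj_sym line_adj_irr.
End LineGraph.

Section Drawing.
Variables (R : realType) (G : sgraph).
Local Open Scope classical_set_scope.
Local Open Scope ring_scope.

(* The edge e is drawn as the image of [0, 1] under [arc e]; the values of
   [arc e] outside [0, 1] are irrelevant. *)
Record drawing := Drawing {
  pos : G -> R * R;
  arc : edge G -> R -> R * R;
  pos_inj : injective pos;
  arc_cont : forall e, {within `[0, 1], continuous (arc e)};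
  arc_inj : forall e, {in `[0, 1] &, injective (arc e)};
  arc_ends : forall e, [set arc e 0; arc e 1] = pos @` [set` val e];
  arc_vertex : forall e t x, t \in `]0, 1[ -> arc e t <> pos x;
  arc_disj : forall e e' s t, e != e' ->
    s \in `]0, 1[ -> t \in `]0, 1[ -> arc e s <> arc e' t }.

Definition drawing_set (D : drawing) : set (R * R) :=
  range (pos D) `|` \bigcup_(e : edge G) (arc D e @` `[0, 1]).

Definition outer_face (D : drawing) (F : set (R * R)) : Prop :=
  exists2 z, (~` drawing_set D) z &
    F = connected_component (~` drawing_set D) z /\ ~ bounded_set F.

Definition boundary (F : set (R * R)) : set (R * R) := closure F `\` interior F.

Definition outerplanar : Prop :=
  exists (D : drawing) (F : set (R * R)),
    outer_face D F /\ forall x, boundary F (pos D x).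
End Drawing.

Section GroupColoring.
Variable H : sgraph.
Local Open Scope classical_set_scope.
Local Open Scope ring_scope.

(* [o x y] means that the edge xy is directed from x to y. *)
Definition orientation (o : rel H) : Prop :=
  forall x y, (o x y -> sadj x y) /\ (sadj x y -> o x y = ~~ o y x).

Definition group_coloring (o : rel H) (A : zmodType) (L : H -> set A)
    (f : edge H -> A) (c : H -> A) : Prop :=
  (forall v, L v (c v)) /\
  forall (e : edge H) x y, val e = [set x; y]%SET -> o x y -> c x - c y <> f e.

(* Reversing an edge amounts to negating f on it, so quantifying over all
   orientations is the same as fixing one. *)
Definition group_colorable (A : zmodType) (L : H -> set A) : Prop :=
  forall o, orientation o -> forall f, exists c, group_coloring o L f c.

Definition group_choosable (k : nat) : Prop :=
  forall A : zmodType, (`I_k #<= [set: A])%card ->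
  forall L : H -> set A, (forall v, L v #= `I_k)%card -> group_colorable L.

Lemma orientation_exists : exists o, orientation o.
Proof.
exists (fun x y => sadj x y && (enum_rank x < enum_rank y)%N) => x y.
split=> [/andP[]//|xy]; rewrite xy sadj_sym xy /=.
have : enum_rank x != enum_rank y.
  by apply/eqP => /enum_rank_inj exy; rewrite exy sadj_irr in xy.
by rewrite -val_eqE /= -leqNgt [in RHS]leq_eqVlt => /negPf ->.
Qed.

Lemma card_pick (A : choiceType) (S : set A) k (B : seq A) :
  (S #= `I_k)%card -> (size B < k)%N -> exists2 a, S a & a \notin B.
Proof.
move=> cS Bk; apply: contrapT => nex.
have SB : S `<=` [set` B].
  by move=> a Sa; apply: contrapT => /negP aB; apply: nex; exists a.
have kB : (`I_k #<= [set` B])%card.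
  by apply: card_le_trans (subset_card_le SB); rewrite (card_le_eqr cS).
have := leq_card_fset_set (finite_seq B) kB.
rewrite leqNgt (leq_ltn_trans _ Bk)//.
have -> : fset_set [set` B] = seq_fset tt B.
  by apply/fsetP => a; rewrite in_fset_set// seq_fsetE mem_setE.
by rewrite size_seq_fset size_undup.
Qed.

Lemma group_choosable_ex : exists k, `[< group_choosable k >].
Proof.
pose N := (#|{: edge H}| * #|H|)%N.
exists (N + N).+1; apply/asboolP => A _ L cL o oP f.
suff /(_ (enum H))[c [cL' cP]] (s : seq H) : exists c : H -> A, (forall v, L v (c v)) /\
    forall (e : edge H) x y, x \in s -> y \in s ->
    val e = [set x; y]%SET -> x != y -> o x y -> c x - c y <> f e.
  exists c; split=> // e x y exy oxy.
  apply: (cP e x y _ _ exy _ oxy); rewrite ?mem_enum//.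
  by apply/eqP => xy; have := (oP x y).1 oxy; rewrite xy sadj_irr.
elim: s => [|v s [c [cL' cP]]].
  have /choice[c cL'] v : exists a, L v a.
    by have [//|a La _] := card_pick (B := [::]) (cL v); exists a.
  by exists c.
pose B := [seq c y + f e | e <- enum {: edge H}, y <- enum H] ++
          [seq c y - f e | e <- enum {: edge H}, y <- enum H].
have [|a La] := card_pick (B := B) (cL v).
  by rewrite size_cat !size_allpairs -!cardE ltnS.
rewrite mem_cat negb_or => /andP[aD aB].
exists (fun x => if x == v then a else c x); split=> [x|e x y].
  by case: eqP => [->|].
rewrite !inE; have [->|xv] := eqVneq x v; have [->|yv] := eqVneq y v => //=.
- move=> _ _ _ _ _ /eqP; rewrite subr_eq => /eqP aE; move/negP: aD; apply.
  by apply/allpairsP; exists (e, y); rewrite /= !mem_enum aE addrC.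
- move=> _ _ _ _ _ /eqP; rewrite subr_eq addrC -subr_eq => /eqP aE.
  move/negP: aB; apply.
  by apply/allpairsP; exists (e, x); rewrite /= !mem_enum aE.
- exact: cP.
Qed.

(* The least k such that H is k-group choosable. *)
Definition chi_gl : nat :=
  ex_minn (P := fun k => `[< group_choosable k >]) group_choosable_ex.
End GroupColoring.

Definition chi_gl' (G : sgraph) : nat := chi_gl (line_graph G).

(* Main.v *)
Require Import Defs.
From mathcomp Require Import all_boot all_order all_algebra.
From mathcomp Require Import all_classical all_reals all_analysis.
From mathcomp Require Import zify lra.
Set Implicit Arguments.
Unset Strict Implicit.
Unset Printing Implicit Defensive.
Import Order.TTheory GRing.Theory Num.Theory.
Import numFieldNormedType.Exports.

(** An upper bound k for the list group chromatic number of a graph follows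
from degeneracy: if every induced subgraph has a vertex with fewer than k
neighbours, then colours can be chosen greedily, since an already coloured
neighbour forbids exactly one group element.  For the line graph of [G] one
needs, in every subgraph of [G] with an edge, an edge xy with
deg x + deg y <= k + 1.  If [G] has maximum degree at most 4, any edge at a vertex of
degree at most 2 will do for k = max_degree + 1.  If the maximum degree is at
least 5, an edge at a vertex of degree 1 or an edge with deg x + deg y <= 6
will do for k = max_degree.

Such edges exist in graphs without subdivisions of K4 and K23.  Excluding K4
and rotating longest paths gives a vertex of degree at most 2 that is not a cut
vertex ([low_degree_vertex]).  Applying this to the graph obtained by
suppressing the vertices of degree 2 gives a vertex where many of these gather,
and a count that uses the absence of K23 yields the light edge ([light_edge]).

An outerplanar graph has no subdivision of K4 or K23 because, after adding a
vertex in the outer face joined to all vertices, it would contain one of K5 or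
K33.  That these are not planar is proved by parity, without the Jordan curve
theorem.  Arcs are replaced by fine chains of points, so that chains of edges
without a common end stay far apart.  For two such edges ab and ce the
difference y - x, for x on ab and y on ce, avoids the origin, and going around
the boundary of this rectangle gives a relation modulo 2 between the winding
parities of ab around c and e, of ce around a and b, and the relative positions
of the four end points ([crossing_cell]).  Summed over all pairs of disjoint
edges of K5 or K33, all terms cancel in pairs and 1 = 0 remains
([parity_obstruction], [K5_odd], [K33_odd]).  Only disjoint pairs of edges
enter, so the chains may meet arbitrarily near a common vertex; in particular
it suffices that each vertex is a limit of points of the outer face
([apex]). *)

(** * Light edges in graphs without weak K4 and K23 subdivisions *)

Section PathsAndMinors.
Variable T : finType.
Implicit Types (e : rel T) (S : {set T}).

(** Walks are only ever used through the set of vertices that they may visit. *)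
Definition linked e S x y :=
  (x \in S) && connect [rel u v | [&& u \in S, v \in S & e u v]] x y.

Lemma linked_sub e e' S S' x y : subrel e e' -> S \subset S' ->
  linked e S x y -> linked e' S' x y.
Proof.
move=> ee' /fintype.subsetP SS' /andP[xS exy]; rewrite /linked (SS' _ xS)/=.
apply: connect_sub exy => u v /= /and3P[uS vS uv].
by apply: connect1; rewrite /= !SS' // (ee' _ _ uv).
Qed.

Lemma linked_trans e S y x z : linked e S x y -> linked e S y z -> linked e S x z.
Proof.
by move=> /andP[xS xy] /andP[_ yz]; rewrite /linked xS (connect_trans xy yz).
Qed.

Lemma linked_in e S x y : linked e S x y -> (x \in S) && (y \in S).
Proof.
move=> /andP[xS /connectP[p]]; rewrite xS => + -> /=.
by elim: p x xS => //= z p IH x xS /andP[/and3P[_ zS _]]; apply: IH.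
Qed.

Lemma linked_sym e S x y : symmetric e -> linked e S x y -> linked e S y x.
Proof.
move=> esym xy; have /andP[xS yS] := linked_in xy; move: xy.
rewrite /linked xS yS /= sym_connect_sym // => u v /=.
by rewrite esym andbCA.
Qed.

Lemma linked_edge e x y : e x y -> linked e [set x; y] x y.
Proof.
by move=> xy; rewrite /linked finset.set21 connect1 //= finset.set21 finset.set22.
Qed.

Definition apart e a b c d := exists S S',
  [/\ linked e S a b, linked e S' c d & [disjoint S & S']].

(** A subdivision of the complete graph on four vertices would have six paths
meeting only at their ends.  Here only the three pairs of opposite paths have
to be disjoint, so more graphs are excluded than by the usual notion.  This is
what the parity argument for drawings delivers, since that argument never looks
at two edges with a common end, and it spares any bookkeeping of internal
disjointness when such walks are exhibited. *)
Definition no_K4 e := forall a b c d,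
  apart e a b c d -> apart e a c b d -> apart e a d b c -> False.

(** The same relaxation for the complete bipartite graph with parts [v], [w] and
the three vertices [m i]: only pairs of walks without a common end have to be
disjoint. *)
Definition no_K23 e := forall v w (m : 'I_3 -> T) (P Q : 'I_3 -> {set T}),
  (forall i, linked e (P i) v (m i)) -> (forall i, linked e (Q i) w (m i)) ->
  ~ (forall i j, i != j -> [disjoint P i & Q j]).

Lemma no_K4_sub e e' : subrel e e' -> no_K4 e' -> no_K4 e.
Proof.
move=> ee' K a b c d.
have L x y z t : apart e x y z t -> apart e' x y z t.
  by move=> [S [S' [h1 h2 dis]]]; exists S, S'; split=> //; apply: linked_sub ee' _ _.
by move=> /L h1 /L h2 /L h3; apply: K h1 h2 h3.
Qed.

Lemma no_K23_sub e e' : subrel e e' -> no_K23 e' -> no_K23 e.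
Proof.
move=> ee' K v w m P Q hP hQ; apply: (K v w m) => i.
  exact: linked_sub (hP i).
exact: linked_sub (hQ i).
Qed.

Definition nbrs e x := [set y | e x y].

(** Vertices are numbered by a function rather than listed, so that reversing an
initial stretch of the path is arithmetic on indices. *)
Definition simple_path e (v : nat -> T) n :=
  (forall k, k < n -> e (v k) (v k.+1)) /\
  (forall j k, j <= n -> k <= n -> v j = v k -> j = k).

Definition longest_path e v n :=
  simple_path e v n /\ forall v' n', simple_path e v' n' -> n' <= n.

Definition subpath (v : nat -> T) n i j : {set T} :=
  [set x | [exists k : 'I_n.+1, (i <= k <= j) && (x == v k)]].

Lemma subpathP (v : nat -> T) n i j x : j <= n ->
  reflect (exists k, i <= k <= j /\ x = v k) (x \in subpath v n i j).
Proof.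
move=> jn; rewrite inE; apply: (iffP existsP) => [[k /andP[ikj /eqP xk]]|].
  by exists k.
move=> [k [/andP[ik kj] ->]].
have kn : k < n.+1 by rewrite ltnS (leq_trans kj).
by exists (Ordinal kn); rewrite /= ik kj eqxx.
Qed.

Lemma subpath_linked e v n i j : simple_path e v n -> i <= j <= n ->
  linked e (subpath v n i j) (v i) (v j).
Proof.
move=> [ev _] /andP[]; elim: j => [|j IH].
  rewrite leqn0 => /eqP -> _; rewrite /linked connect0 andbT.
  by apply/subpathP => //; exists 0.
rewrite leq_eqVlt => /orP[/eqP->|ij] jn.
  rewrite /linked connect0 andbT.
  by apply/subpathP => //; exists j.+1; rewrite leqnn.
have S' := IH ij (ltnW jn); apply: (@linked_trans _ _ (v j)).
  apply: linked_sub S' => //; apply/fintype.subsetP => x.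
  move=> /(subpathP _ _ _ (ltnW jn))[k [ikj ->]].
  by apply/subpathP => //; exists k; split=> //; lia.
have m k : i <= k <= j.+1 -> v k \in subpath v n i j.+1.
  by move=> h; apply/subpathP => //; exists k.
by rewrite /linked m ?connect1 //= ?m ?ev //; lia.
Qed.

Lemma simple_path_size e v n : simple_path e v n -> n < #|T|.
Proof.
move=> [_ vinj]; have f_inj : injective (fun k : 'I_n.+1 => v k).
  by move=> j k /vinj jk; apply/val_inj/jk; rewrite -ltnS.
by have := leq_card _ f_inj; rewrite card_ord.
Qed.

(** Otherwise the neighbour could be put in front of the path. *)
Lemma longest_nbr e v n y : symmetric e -> longest_path e v n -> e (v 0) y ->
  exists2 k, k <= n & v k = y.
Proof.
move=> esym [[ev vinj] vmax] v0y.
have [/existsP[k /eqP vk]|/existsPn nex] := boolP [exists k : 'I_n.+1, v k == y].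
  by exists k; rewrite // -ltnS.
have yv k : k <= n -> v k <> y.
  by move=> kn vk; have := nex (Ordinal (kn : k < n.+1)); rewrite vk eqxx.
pose v' k := if k is k'.+1 then v k' else y.
suff /vmax : simple_path e v' n.+1 by rewrite ltnn.
split=> [[|k] //= kn|[|j] [|k] //= jn kn]; first by rewrite esym.
- exact: ev.
- by move=> h; case: (yv k).
- by move=> h; case: (yv j).
- by move=> /vinj ->.
Qed.

(** Posa's rotation: when [v 0] is adjacent to [v i], the path
v (i-1), ..., v 0, v i, ..., v n has the same vertices and starts at
[v (i-1)]. *)
Definition reroute (v : nat -> T) i k := if k < i then v (i.-1 - k) else v k.

Lemma longest_reroute e v n i : symmetric e -> longest_path e v n ->
  0 < i <= n -> e (v 0) (v i) -> longest_path e (reroute v i) n.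
Proof.
move=> esym [[ev vinj] vmax] /andP[i0 lein] v0i; split=> //; split=> [k kn|j k jn kn].
  rewrite /reroute; case: (ltnP k.+1 i) => k1i.
    rewrite ltnW // esym; have -> : i.-1 - k = (i.-1 - k.+1).+1 by lia.
    by apply: ev; lia.
  case: ltnP => ki; last exact: ev.
  have -> : i.-1 - k = 0 by lia.
  by have -> : k.+1 = i by lia.
rewrite /reroute; case: ifP => ji; case: ifP => ki /vinj; lia.
Qed.

(** With m the smaller of j and l, the four branch vertices are [v 0],
[v (i-1)], [v i] and [v m]; the chords leaving [v 0] and [v (i-1)] continue
along the path down to [v m]. *)
Lemma crossing_chords_K4 e v n i j l : symmetric e -> no_K4 e -> simple_path e v n ->
  1 < i -> i < j <= n -> i < l <= n ->
  e (v 0) (v i) -> e (v 0) (v j) -> e (v i.-1) (v l) -> False.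
Proof.
move=> esym K sp i1 /andP[ij jn] /andP[il ln] v0i v0j vil.
have [ev vinj] := sp.
(* The first of the two chord ends met when walking up from [v i]. *)
pose m := minn j l.
have back k : m <= k <= n -> linked e (subpath v n m k) (v k) (v m).
  by move=> mk; apply: linked_sym esym _; apply: subpath_linked sp _.
have via x k : m <= k <= n -> e x (v k) ->
    linked e (x |: subpath v n m k) x (v m).
  move=> mk xk; apply: (@linked_trans _ _ (v k)).
    apply: linked_sub (linked_edge xk) => //; apply/fintype.subsetP => y.
    rewrite !inE => /orP[->//|/eqP->]; apply/orP; right.
    have kn : k < n.+1 by lia.
    by apply/existsP; exists (Ordinal kn); rewrite eqxx andbT /=; lia.
  by apply: linked_sub (back _ mk) => //; apply: finset.subsetUr.
have dis (S S' : {set T}) (I J : pred nat) :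
    (forall x, x \in S -> exists2 k, I k && (k <= n) & x = v k) ->
    (forall x, x \in S' -> exists2 k, J k && (k <= n) & x = v k) ->
    (forall k, I k -> J k -> False) -> [disjoint S & S'].
  move=> hI hJ IJ; apply/pred0P => x /=; apply/negP => /andP[/hI[k /andP[Ik kn] ->]].
  by move=> /hJ[k' /andP[Jk' k'n] /(vinj _ _ kn k'n) kk']; apply: (IJ k); rewrite // kk'.
have seg a b x : b <= n -> x \in subpath v n a b -> exists2 k, (a <= k <= b) && (k <= n) & x = v k.
  by move=> bn /(subpathP _ _ _ bn)[k [h ->]]; exists k => //; lia.
have segU c a b x : c <= n -> b <= n -> x \in v c |: subpath v n a b ->
    exists2 k, ((k == c) || (a <= k <= b)) && (k <= n) & x = v k.
  move=> cn bn /finset.setU1P[->|/(seg _ _ _ bn)[k h ->]]; first by exists c; rewrite ?eqxx.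
  by exists k => //; lia.
have pair c c' x : c <= n -> c' <= n -> x \in [set v c; v c'] ->
    exists2 k, ((k == c) || (k == c')) && (k <= n) & x = v k.
  by move=> cn c'n /finset.set2P[]->; [exists c|exists c'] => //; rewrite eqxx ?orbT; lia.
apply: (K (v 0) (v i.-1) (v i) (v m)).
- exists (subpath v n 0 i.-1), (subpath v n i m); split.
  + by apply: subpath_linked sp _; lia.
  + by apply: subpath_linked sp _; lia.
  + by apply: dis (fun x => seg _ _ x _) (fun x => seg _ _ x _) _ => [||k]; lia.
- exists [set v 0; v i], (v i.-1 |: subpath v n m l); split.
  + exact: linked_edge.
  + by apply: via => //; lia.
  + by apply: dis (fun x => pair _ _ x _ _) (fun x => segU _ _ _ x _ _) _ => [||||k]; lia.
- exists (v 0 |: subpath v n m j), [set v i.-1; v i]; split.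
  + by apply: via => //; lia.
  + by apply: linked_edge; have := ev i.-1; rewrite prednK; [apply|]; lia.
  + by apply: dis (fun x => segU _ _ _ x _ _) (fun x => pair _ _ x _ _) _ => [||||k]; lia.
Qed.

Lemma other_nbr e v n a b : symmetric e -> longest_path e v n ->
  2 < #|nbrs e (v 0)| -> exists2 k, k <= n & [/\ e (v 0) (v k), v k != a & v k != b].
Proof.
move=> esym vl d3.
have : 0 < #|nbrs e (v 0) :\: [set a; b]|.
  rewrite cardsD subn_gt0 (leq_ltn_trans _ d3) //.
  rewrite (leq_trans (fintype.subset_leq_card (finset.subsetIr _ _))) //.
  by rewrite cards2; case: (_ != _).
rewrite card_gt0 => /finset.set0Pn[y]; rewrite !inE negb_or => /andP[/andP[ya yb] v0y].
by have [k kn vk] := longest_nbr esym vl v0y; exists k; rewrite // vk.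
Qed.

(** Let [v 0] have a neighbour [v i] with i at least 2, and a further one [v k];
by induction k is larger than i.  After a rotation the path starts at
[v (i-1)].  If that vertex has degree at least 3, it has a neighbour [v l]
besides its two neighbours on the path.  When l is larger than i the chords
form a forbidden K4; otherwise the neighbour gets a smaller index in the
rotated path, and the induction applies there. *)
Lemma longest_path_low_degree e v n i : symmetric e -> irreflexive e -> no_K4 e ->
  longest_path e v n -> 1 < i <= n -> e (v 0) (v i) ->
  exists2 v', longest_path e v' n & #|nbrs e (v' 0)| <= 2.
Proof.
move=> esym eirr K; elim/ltn_ind: i v => i IH v vl /andP[i1 lein] v0i.
have [d2|d3] := leqP #|nbrs e (v 0)| 2; first by exists v.
have [k kn [v0k kv1 kvi]] := other_nbr (v 1) (v i) esym vl d3.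
have k1 : 1 < k.
  case: k kv1 v0k {kn kvi} => [|[|//]]; first by rewrite eirr.
  by rewrite eqxx.
have [ki|ik|ik] := ltngtP k i; first by apply: (IH k) vl _ v0k; rewrite ?k1.
  have i0 : 0 < i <= n by lia.
  have wl := longest_reroute esym vl i0 v0i.
  have w0 : reroute v i 0 = v i.-1 by rewrite /reroute subn0; case: ifP => //; lia.
  have [d2|e3] := leqP #|nbrs e (reroute v i 0)| 2; first by exists (reroute v i).
  have [l ln [w0l l2 lvi]] := other_nbr (v i.-2) (v i) esym wl e3.
  have [li|il] := ltnP l i.
    apply: (IH l li _ wl _ w0l); rewrite ln andbT.
    case: l w0l l2 {ln li lvi} => [|[|//]]; first by rewrite eirr.
    rewrite /reroute i1; have -> : i.-1 - 1 = i.-2 by lia.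
    by rewrite eqxx.
  rewrite {2}/reroute ltnNge il /= in w0l.
  rewrite {1}/reroute ltnNge il /= in lvi.
  rewrite w0 in w0l.
  exfalso; apply: (crossing_chords_K4 esym K vl.1 i1 _ _ v0i v0k w0l); rewrite ?ik ?kn // ln andbT.
  by rewrite ltn_neqAle il andbT; apply: contra_neq lvi => ->.
by rewrite ik eqxx in kvi.
Qed.

(** A path of maximal length exists as its length is less than the number of vertices. *)
Lemma longest_path_ex e x y : irreflexive e -> e x y ->
  exists v n, longest_path e v n /\ 0 < n.
Proof.
move=> eirr exy.
pose Q n := [exists t : {ffun 'I_n.+1 -> T}, [forall j : 'I_n.+1, forall k : 'I_n.+1,
   ((k == j.+1 :> nat) ==> e (t j) (t k)) && ((t j == t k) ==> (j == k))]].
have QP n : reflect (exists v, simple_path e v n) (Q n).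
  apply: (iffP existsP) => [[t /forallP tP]|[v [ev vinj]]].
    exists (fun k => t (inord k)); split=> [k kn|j k jn kn].
      have /forallP/(_ (inord k.+1))/andP[/implyP + _] := tP (inord k).
      by rewrite !inordK ?ltnS ?(ltnW kn) //; apply.
    have /forallP/(_ (inord k))/andP[_ /implyP h] := tP (inord j).
    move=> /eqP/h/eqP/(congr1 val) /=; by rewrite !inordK.
  exists [ffun k : 'I_n.+1 => v k]; apply/forallP => j; apply/forallP => k.
  rewrite !ffunE; apply/andP; split; apply/implyP => /eqP.
    by move=> kj; rewrite kj; apply: ev; rewrite -kj -ltnS ltn_ord.
  by move/vinj => jk; apply/eqP/val_inj/jk; rewrite -ltnS ltn_ord.
have Q1 : Q 1.
  apply/QP; exists (fun k => if k is 0 then x else y).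
  have xy : x <> y by move=> xy; rewrite xy eirr in exy.
  by split=> [[|k]//|[|[|j]] [|[|k]] //= _ _ h]; case: xy.
have Qb n : Q n -> n <= #|T| by move=> /QP[v /simple_path_size/ltnW].
have exQ : exists n, Q n by exists 1.
case: (ex_maxnP exQ Qb) => n /QP[v vs] nmax.
exists v, n; split; last exact: nmax.
by split=> // v' n' vs'; apply: nmax; apply/QP; exists v'.
Qed.

(** The start of a suitable longest path has degree at most 2 and all its
neighbours on the path, so deleting it leaves them connected to each other.
The case [x = y] covers degree 1. *)
Lemma low_degree_vertex e a b : symmetric e -> irreflexive e -> no_K4 e -> e a b ->
  exists v x y S, [/\ e v x, e v y, nbrs e v \subset [set x; y], v \notin S & linked e S x y].
Proof.
move=> esym eirr K ab; have [v [n [vl n0]]] := longest_path_ex eirr ab.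
have [v' vl' d2] : exists2 v', longest_path e v' n & #|nbrs e (v' 0)| <= 2.
  have [|d3] := leqP #|nbrs e (v 0)| 2; first by exists v.
  have [k kn [v0k k1 _]] := other_nbr (v 1) (v 1) esym vl d3.
  apply: (longest_path_low_degree esym eirr K vl _ v0k); rewrite kn andbT.
  case: k v0k k1 {kn} => [|[|//]]; first by rewrite eirr.
  by rewrite eqxx.
have v01 : e (v' 0) (v' 1) by apply: vl'.1.1.
have [N1|] := boolP (nbrs e (v' 0) \subset [set v' 1]).
  exists (v' 0), (v' 1), (v' 1), [set v' 1]; rewrite finset.setUid; split=> //.
    by rewrite inE; apply/eqP => h; rewrite -h eirr in v01.
  by rewrite /linked finset.set11 connect0.
move=> /fintype.subsetPn[y]; rewrite !inE => v0y y1.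
have [k kn vk] := longest_nbr esym vl' v0y.
have k0 : 0 < k by case: k vk {kn} => // h; rewrite -h eirr in v0y.
exists (v' 0), (v' 1), y, (subpath v' n 1 k); split=> //.
- have sub : [set v' 1; y] \subset nbrs e (v' 0).
    by apply/fintype.subsetP => z /finset.set2P[]->; rewrite inE.
  have /eqP <- : [set v' 1; y] == nbrs e (v' 0).
    by rewrite eqEcard sub cards2 eq_sym y1.
  exact: fintype.subxx.
- apply/(subpathP _ _ _ kn) => -[j [j1 /vl'.1.2 j0]].
  by have := j0 (leq0n _) (leq_trans (proj2 (andP j1)) kn); lia.
- by rewrite -vk; apply: subpath_linked vl'.1 _; lia.
Qed.


Section LightEdge.
Variable e : rel T.
Hypotheses (esym : symmetric e) (eirr : irreflexive e).

Definition degree2 u := #|nbrs e u| == 2.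

(** The graph obtained by replacing each path through a vertex of degree 2 by an
edge.  Vertices of low degree in it are the places where vertices of degree 2
accumulate in the original graph. *)
Definition suppress : rel T := fun x y =>
  [&& x != y, ~~ degree2 x, ~~ degree2 y & e x y || [exists u, [&& degree2 u, e u x & e u y]]].

Lemma suppress_sym : symmetric suppress.
Proof.
move=> x y; rewrite /suppress eq_sym esym; congr (_ && _).
rewrite andbCA; congr [&& _, _ & _ || _].
by apply: eq_existsb => u; congr (_ && _); rewrite andbC.
Qed.

Lemma suppress_irr : irreflexive suppress.
Proof. by move=> x; rewrite /suppress eqxx. Qed.

(** An edge of the suppressed graph inside [S] may stand for a path through a
vertex of degree 2; this set is where such paths live. *)
Definition thicken (S : {set T}) :=
  [set z in S | ~~ degree2 z] :|: [set u | degree2 u && (nbrs e u \subset S)].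

Lemma thicken_linked (S : {set T}) x y : linked suppress S x y -> ~~ degree2 x ->
  linked e (thicken S) x y.
Proof.
move=> /andP[xS xy] x2; rewrite /linked !inE xS x2 /=.
apply: connect_sub xy => u v /= /and3P[uS vS /and4P[uv u2 v2]].
have uF : u \in thicken S by rewrite !inE u2 uS.
have vF : v \in thicken S by rewrite !inE v2 vS.
case/orP => [euv|/existsP[w /and3P[w2 wu wv]]]; first by apply: connect1; rewrite /= uF vF.
have wS : w \in thicken S.
  rewrite !inE w2 andbF /=.
  have /eqP <- : [set u; v] == nbrs e w.
    rewrite eqEcard cards2 uv (eqP w2) andbT.
    by apply/fintype.subsetP => z /finset.set2P[]->; rewrite inE.
  by apply/fintype.subsetP => z /finset.set2P[]->.
apply: (@connect_trans _ _ w); apply: connect1; rewrite /= ?uF ?vF ?wS //.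
by rewrite esym.
Qed.

(** A vertex of degree 2 has a neighbour, which cannot lie in both sets. *)
Lemma thicken_disjoint (S S' : {set T}) : [disjoint S & S'] ->
  [disjoint thicken S & thicken S'].
Proof.
move=> /pred0P dis; apply/pred0P => z /=; apply/negP => /andP[].
have dis' x : x \in S -> x \in S' -> False.
  by move=> xS xS'; have := dis x; rewrite /= xS xS'.
rewrite !inE => /orP[/andP[zS z2]|/andP[z2 /fintype.subsetP sS]].
  all: case/orP=> [/andP[zS' z2']|/andP[z2' /fintype.subsetP sS']].
- exact: dis' zS zS'.
- by rewrite z2' in z2.
- by rewrite z2 in z2'.
- have d2 := eqP z2.
  have : 0 < #|nbrs e z| by rewrite d2.
  by rewrite card_gt0 => /finset.set0Pn[y yz]; apply: dis' (sS _ yz) (sS' _ yz).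
Qed.

Lemma suppress_no_K4 : no_K4 e -> no_K4 suppress.
Proof.
move=> K a b c d.
have L x y (S : {set T}) : linked suppress S x y -> x != y -> ~~ degree2 x.
  move=> /andP[_ /connectP[[|z p] /= + ->]]; rewrite ?eqxx //.
  by move=> /andP[/and3P[_ _ /and4P[]]].
have D x y z t : apart suppress x y z t -> (x != z) && (x != t) && (y != z) && (y != t).
  move=> [S [S' [/linked_in/andP[xS yS] /linked_in/andP[zS tS] dis]]].
  have ne p q : p \in S -> q \in S' -> p != q.
    by move=> pS; apply: contraTneq => <-; rewrite (disjointFr dis pS).
  by rewrite !ne.
have A x y z t : x != y -> z != t -> apart suppress x y z t -> apart e x y z t.
  move=> xy zt [S [S' [h1 h2 dis]]]; exists (thicken S), (thicken S').
  split; last exact: thicken_disjoint.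
    exact/thicken_linked/(L _ _ _ h1).
  exact/thicken_linked/(L _ _ _ h2).
move=> h1 h2 h3; have := D _ _ _ _ h1; have := D _ _ _ _ h2; have := D _ _ _ _ h3.
rewrite -!andbA => /and4P[? ? ? ?] /and4P[? ? ? ?] /and4P[? ? ? ?].
by apply: (K a b c d); apply: A => //; rewrite eq_sym.
Qed.

Definition common v x := [set u | [&& degree2 u, e u v & e u x]].

(** Three common neighbours of degree 2 would be the middle vertices of a K23. *)
Lemma common_le2 v x : v != x -> no_K23 e -> ~~ degree2 v -> ~~ degree2 x -> #|common v x| <= 2.
Proof.
move=> vx K v2 x2; rewrite leqNgt; apply/negP => /card_gt2P[a [b [c [[]]]]].
rewrite !inE => /and3P[a2 av ax] /and3P[b2 bv bx] /and3P[c2 cv cx] [ab bc ca].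
pose m (i : 'I_3) := nth a [:: a; b; c] i.
have mP i : [&& degree2 (m i), e (m i) v & e (m i) x].
  by rewrite /m; case: i => [[|[|[|]]]] //= _; apply/and3P.
have m_inj i j : i != j -> m i != m j.
  case: i j => [[|[|[|]]]] //= ? [[|[|[|]]]] //= ? _; rewrite /m //=; by rewrite // eq_sym.
apply: (K v x m (fun i => [set v; m i]) (fun i => [set x; m i])) => [i|i|i j ij].
- by apply: linked_edge; rewrite esym; have /and3P[] := mP i.
- by apply: linked_edge; rewrite esym; have /and3P[] := mP i.
- have /and3P[mi _ _] := mP i; have /and3P[mj _ _] := mP j.
  have N z : degree2 z -> (z != v) && (z != x).
    by move=> z2; apply/andP; split; apply: contraTneq z2 => ->.
  have /andP[miv mix] := N _ mi; have /andP[mjv mjx] := N _ mj.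
  rewrite finset.disjoints_subset; apply/fintype.subsetP => z /finset.set2P[]->;
    rewrite !inE negb_or ?vx ?mix ?m_inj //.
  by rewrite eq_sym.
Qed.

(** If there were two, then [y] would be a third middle vertex: it is joined to
[v] by an edge of the suppressed graph and to [x] within [S], avoiding [v]. *)
Lemma common_le1 v x y (S : {set T}) : no_K23 e -> x != y -> suppress v x -> suppress v y ->
  v \notin S -> linked suppress S x y -> #|common v x| <= 1.
Proof.
move=> K xy /and4P[vx v2 x2 _] vy vS lS; rewrite leqNgt; apply/negP => /card_gt1P[a [b []]].
rewrite !inE => /and3P[a2 av ax] /and3P[b2 bv bx] ab.
have y2 : ~~ degree2 y by case/and4P: vy.
have N z : degree2 z -> (z != v) && (z != x).
  by move=> z2; apply/andP; split; apply: contraTneq z2 => ->.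
have /andP[av' ax'] := N _ a2; have /andP[bv' bx'] := N _ b2.
have avS z (S' : {set T}) w : w \in nbrs e z -> degree2 z -> w \notin S' -> z \notin thicken S'.
  move=> zw z2 wS'; rewrite !inE z2 andbF /=; apply: contra wS' => /fintype.subsetP; exact.
pose m (i : 'I_3) := nth a [:: a; b; y] i.
pose P (i : 'I_3) := nth finset.set0 [:: [set v; a]; [set v; b]; thicken [set v; y]] i.
pose Q (i : 'I_3) := nth finset.set0 [:: [set x; a]; [set x; b]; thicken S] i.
have vF : v \notin thicken S by rewrite !inE (negPf vS) (negPf v2).
have xF : x \notin thicken [set v; y].
  by rewrite !inE (negPf xy) eq_sym (negPf vx) (negPf x2).
have aF : a \notin thicken S by apply: avS vS => //; rewrite inE.
have bF : b \notin thicken S by apply: avS vS => //; rewrite inE.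
have xvy : x \notin [set v; y] by rewrite !inE negb_or eq_sym vx.
have aF' : a \notin thicken [set v; y] by apply: avS xvy => //; rewrite inE.
have bF' : b \notin thicken [set v; y] by apply: avS xvy => //; rewrite inE.
have D p q (A : {set T}) : p \notin A -> q \notin A -> [disjoint [set p; q] & A].
  move=> pA qA; rewrite finset.disjoints_subset; apply/fintype.subsetP => z.
  by case/finset.set2P=> ->; rewrite inE.
apply: (K v x m P Q) => [[[|[|[|]]]]|[[|[|[|]]]]|[[|[|[|]]]] //= ? [[|[|[|]]]]] //= ?.
all: rewrite /P /Q /m /=.
- by apply: linked_edge; rewrite esym.
- by apply: linked_edge; rewrite esym.
- exact/thicken_linked/v2/linked_edge.
- by apply: linked_edge; rewrite esym.
- by apply: linked_edge; rewrite esym.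
- exact: thicken_linked.
- by move=> _; apply: D; rewrite !inE negb_or ?vx ?ab ?ax' // eq_sym.
- by move=> _; apply: D.
- by move=> _; apply: D; rewrite !inE negb_or ?vx ?bx' // eq_sym // ab.
- by move=> _; apply: D.
- by move=> _; rewrite disjoint_sym; apply: D.
- by move=> _; rewrite disjoint_sym; apply: D.
Qed.

(** Suppose that every edge has degree sum at least 7 and there is no vertex of
degree 1.  Then vertices of degree 2 are adjacent only to vertices of degree at
least 5.  Take a vertex [v] of degree at most 2 in the suppressed graph that
does not separate its neighbours [x] and [y].  In the original graph it has a
neighbour of degree 2, hence degree at least 5; but all its neighbours are [x],
[y] or vertices of degree 2 whose other neighbour is [x] or [y], and there are
too few of the latter by the two preceding lemmas. *)
Lemma light_edge a b : no_K4 e -> no_K23 e -> e a b ->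
  exists x y, e x y /\ (#|nbrs e x| <= 1 \/ #|nbrs e x| + #|nbrs e y| <= 6).
Proof.
move=> K4 K23 ab.
have [|] := boolP [exists x, exists y, e x y &&
    ((#|nbrs e x| <= 1) || (#|nbrs e x| + #|nbrs e y| <= 6))].
  by move=> /existsP[x /existsP[y /andP[xy /orP h]]]; exists x, y.
move=> /existsPn nex; exfalso.
have heavy x y : e x y -> 1 < #|nbrs e x| /\ 6 < #|nbrs e x| + #|nbrs e y|.
  move=> xy; move/existsPn: (nex x) => /(_ y); rewrite xy negb_or -!ltnNge => /andP[]; by split.
have degree2_nbr u x : degree2 u -> e u x -> 4 < #|nbrs e x|.
  by move=> /eqP d2 /heavy[]; rewrite d2; lia.
have degree2_nbr2 u x : degree2 u -> e u x -> ~~ degree2 x.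
  by move=> u2 /(degree2_nbr _ _ u2); rewrite /degree2; case: eqP => // ->.
have other u x : degree2 u -> e u x -> exists z, suppress x z /\ e u z.
  move=> u2 ux; have : 0 < #|nbrs e u :\ x|.
    by have := cardsD1 x (nbrs e u); rewrite (eqP u2) inE ux; lia.
  rewrite card_gt0 => /finset.set0Pn[z]; rewrite !inE => /andP[zx uz].
  exists z; split=> //; apply/and4P; split; rewrite 1?eq_sym // ?(degree2_nbr2 u) //.
  by apply/orP; right; apply/existsP; exists u; rewrite u2 ux.
have [a' [b' ab']] : exists a' b', suppress a' b'.
  have [a2|a2] := boolP (degree2 a).
    by have [z [bz _]] := other a b a2 ab; exists b, z.
  have [b2|b2] := boolP (degree2 b).
    by rewrite esym in ab; have [z [az _]] := other b a b2 ab; exists a, z.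
  exists a, b; apply/and4P; split=> //; last by rewrite ab.
  by apply/eqP => h; rewrite h eirr in ab.
have [v [x [y [S [vx vy Nv vS lS]]]]] :=
  low_degree_vertex suppress_sym suppress_irr (suppress_no_K4 K4) ab'.
have [vx' v2 x2 _] := and4P vx; have [vy' _ y2 _] := and4P vy.
(* Neighbours of degree other than 2 remain adjacent to [v]; those of degree 2 lead
   to [x] or [y]. *)
have sub : nbrs e v \subset [set x; y] :|: common v x :|: common v y.
  apply/fintype.subsetP => z; rewrite inE => vz.
  have [z2|z2] := boolP (degree2 z).
    rewrite esym in vz; have [t [vt zt]] := other z v z2 vz.
    have /(fintype.subsetP Nv)/finset.set2P[] : t \in nbrs suppress v by rewrite inE.
      by move=> tx; rewrite 2!inE [z \in common v x]inE z2 vz -tx zt orbT.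
    by move=> ty; rewrite inE [z \in common v y]inE z2 vz -ty zt orbT.
  rewrite 2!inE (fintype.subsetP Nv) // inE; apply/and4P; split=> //; last by rewrite vz.
  by apply/eqP => h; rewrite h eirr in vz.
have cle := leq_trans (fintype.subset_leq_card sub) (leq_card_setU _ _).
have {}cle := leq_trans cle (leq_add (leq_card_setU _ _) (leqnn _)).
have v5 : 4 < #|nbrs e v|.
  have [/finset.set0Pn[u]|/negPn/eqP c0] := boolP (common v x :|: common v y != finset.set0).
    by rewrite !inE => /orP[]/and3P[u2 uv _]; apply: (degree2_nbr u).
  exfalso; move: sub; rewrite -finset.setUA c0 finset.setU0 => /fintype.subset_leq_card.
  have [w vw] : exists w, e v w.
    case/and4P: vx => _ _ _ /orP[vx|/existsP[u /and3P[_ uv _]]]; first by exists x.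
    by exists u; rewrite esym.
  have [+ _] := heavy _ _ vw; move: v2; rewrite /degree2 cards2 => /eqP.
  by case: (x != y) => /=; move: #|nbrs e v|; clear; lia.
have [xy|xy] := eqVneq x y.
  have := common_le2 vx' K23 v2 x2; subst y.
  have := fintype.subset_leq_card sub; rewrite -finset.setUA !finset.setUid.
  have [+ _] := leq_card_setU [set x] (common v x); rewrite cards1 => h1 h2 h3.
  by move: (leq_trans v5 (leq_trans h2 (leq_trans h1 (leq_add (leqnn 1) h3)))).
have := common_le1 K23 xy vx vy vS lS.
have := common_le1 K23 _ vy vx vS (linked_sym suppress_sym lS); rewrite eq_sym => /(_ xy).
move: cle; rewrite cards2 xy; move: v5.
by move: #|common v x| #|common v y| #|nbrs e v|; clear; lia.
Qed.

End LightEdge.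
End PathsAndMinors.

(** * Degenerate line graphs are group choosable *)

Section GreedyColoring.
Local Open Scope ring_scope.

(** Greedy colouring: the vertex found is coloured last, when each of its
neighbours forbids exactly one element of its list.  Removing vertices keeps
the hypothesis, which speaks of all subsets. *)
Lemma degenerate_choosable (H : sgraph) k :
  (forall X : {set H}, X != finset.set0 ->
    exists2 v, v \in X & (#|[set y in X | sadj v y]| < k)%N) ->
  group_choosable H k.
Proof.
move=> deg A _ L cL o oP f.
have k0 (v : H) : (0 < k)%N.
  have [|w _] := deg [set: H]; last exact: leq_ltn_trans.
  by apply/finset.set0Pn; exists v; rewrite inE.
suff /(_ [set: H])[c [cL' cP]] (X : {set H}) : exists c : H -> A, (forall v, L v (c v)) /\
    forall (e : edge H) x y, x \in X -> y \in X ->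
    val e = [set x; y] -> o x y -> c x - c y <> f e.
  by exists c; split=> // e x y; apply: cP.
have [n] := ubnP #|X|; elim: n X => // n IH X cX.
have [->|/deg[v vX vk]] := eqVneq X finset.set0.
  have /choice[c cL'] v : exists a, L v a.
    by have [|a La _] := card_pick (B := [::]) (cL v); [exact: k0|exists a].
  by exists c; split=> // e x y; rewrite inE.
have [|c [cL' cP]] := IH (X :\ v); first by move: cX; rewrite (cardsD1 v) vX.
pose F y := if insub [set v; y] is Some e then f e else 0.
pose B := [seq (if o v y then c y + F y else c y - F y) | y <- enum [set y in X | sadj v y]].
have [|a La aB] := card_pick (B := B) (cL v); first by rewrite size_map -cardE.
have FE (e : edge H) y : val e = [set v; y] -> F y = f e.
  by move=> vy; rewrite /F -vy valK.
exists (fun x => if x == v then a else c x); split=> [x|e x y xX yX exy oxy].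
  by case: eqP => [->|].
have xy : sadj x y := (oP x y).1 oxy.
have xNy : x != y by apply: contraTneq xy => ->; rewrite sadj_irr.
have [xv|xv] := eqVneq x v; have [yv|yv] := eqVneq y v.
- by rewrite xv yv eqxx in xNy.
- subst x; move=> /eqP; rewrite subr_eq addrC => /eqP aE; move/negP: aB; apply.
  by apply/mapP; exists y; rewrite ?mem_enum ?inE ?yX // oxy (FE e).
- subst y; move=> /eqP; rewrite subr_eq addrC -subr_eq => /eqP aE; move/negP: aB; apply.
  apply/mapP; exists x; first by rewrite mem_enum inE xX sadj_sym.
  have vx : sadj v x by rewrite sadj_sym.
  rewrite ((oP v x).2 vx) oxy /= (FE e) //.
  by rewrite exy finset.setUC.
- by apply: cP => //; rewrite !inE ?xv ?yv.
Qed.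

Lemma chi_gl_le (H : sgraph) k : group_choosable H k -> (chi_gl H <= k)%N.
Proof. by move=> hk; rewrite /chi_gl; case: ex_minnP => m _; apply; apply/asboolP. Qed.

(** Sets of vertices of the line graph are sets of edges of [G], hence subgraphs
of [G] to which structural results about [G] apply. *)
Definition spanned (G : sgraph) (X : {set edge G}) : rel G :=
  fun x y => [exists f in X, val f == [set x; y]].

Lemma edge_ends (G : sgraph) (f : edge G) : exists x y, sadj x y /\ val f = [set x; y].
Proof.
by have := valP f; rewrite inE => /existsP[x /existsP[y /andP[xy /eqP ?]]]; exists x, y.
Qed.

Lemma edge_adj (G : sgraph) (f : edge G) x y : val f = [set x; y] -> sadj x y.
Proof.
have [a [b [ab ->]]] := edge_ends f.
have aNb : a != b by apply: contraTneq ab => ->; rewrite sadj_irr.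
move=> E; have : a \in [set x; y] by rewrite -E set21.
have : b \in [set x; y] by rewrite -E set22.
move=> /set2P[] bE /set2P[] aE; move: ab aNb; rewrite aE bE ?eqxx //.
by rewrite sadj_sym.
Qed.

Lemma spanned_sub (G : sgraph) (X : {set edge G}) : subrel (spanned X) (@sadj G).
Proof. by move=> x y /existsP[f /andP[_ /eqP /edge_adj]]. Qed.

Lemma spanned_sym (G : sgraph) (X : {set edge G}) : symmetric (spanned X).
Proof. by move=> x y; rewrite /spanned finset.setUC. Qed.

Lemma spanned_irr (G : sgraph) (X : {set edge G}) : irreflexive (spanned X).
Proof. by move=> x; apply: contraTF isT => /spanned_sub; rewrite sadj_irr. Qed.

Lemma spanned_degree (G : sgraph) (X : {set edge G}) x :
  (#|nbrs (spanned X) x| <= max_degree G)%N.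
Proof.
apply: leq_trans (leq_bigmax x); apply: subset_leq_card; apply/fintype.subsetP => y.
by rewrite !inE; apply: spanned_sub.
Qed.

(** An edge adjacent to the edge xy is determined by its other end, which is a
neighbour of [x] distinct from [y] or a neighbour of [y] distinct from [x]. *)
Lemma line_degree (G : sgraph) (X : {set edge G}) (f : edge G) x y :
  f \in X -> val f = [set x; y] ->
  (#|[set g in X | line_adj f g]|.+2 <= #|nbrs (spanned X) x| + #|nbrs (spanned X) y|)%N.
Proof.
move=> fX fxy; set e := spanned X.
have exy : e x y by apply/existsP; exists f; rewrite fX fxy eqxx.
have eyx : e y x by rewrite /e spanned_sym.
rewrite (cardsD1 y (nbrs e x)) (cardsD1 x (nbrs e y)) !inE exy eyx /=.
rewrite addnS !addSn addnC !ltnS -(card_imset _ val_inj).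
apply: leq_trans (leq_add (leq_imset_card (fun z => [set y; z]) _)
                          (leq_imset_card (fun z => [set x; z]) _)).
apply: leq_trans (leq_card_setU _ _); apply: subset_leq_card.
apply/fintype.subsetP => _ /finset.imsetP[g + ->]; rewrite !inE => /andP[gX].
rewrite /line_adj /= => /andP[fg /finset.set0Pn[z]]; rewrite inE fxy => /andP[zxy].
have ends a b : val g = [set a; b] -> z == a ->
   (val g \in [set [set y; z0] | z0 in nbrs e y :\ x]) ||
   (val g \in [set [set x; z0] | z0 in nbrs e x :\ y]).
  move=> gab /eqP za; subst a; have ezb : e z b by apply/existsP; exists g; rewrite gX gab eqxx.
  case/set2P: zxy => zE; subst z; apply/orP; [right|left]; rewrite gab;
    apply/finset.imsetP; exists b => //;
    rewrite !inE ezb andbT; apply: contraNneq fg => bE; rewrite -val_eqE /= fxy gab bE //.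
  by rewrite finset.setUC.
have [a [b [_ gab]]] := edge_ends g; rewrite gab => /set2P[|] h.
  by rewrite -gab; apply: (ends a b); rewrite ?h.
by rewrite -gab; apply: (ends b a); rewrite ?h // finset.setUC.
Qed.

Lemma chi_gl'_le (G : sgraph) k :
  (forall X : {set edge G}, X != finset.set0 -> exists x y, spanned X x y /\
    (#|nbrs (spanned X) x| + #|nbrs (spanned X) y| <= k.+1)%N) ->
  (chi_gl' G <= k)%N.
Proof.
move=> h; apply/chi_gl_le/degenerate_choosable => X /h[x [y [/existsP[f /andP[fX /eqP fxy]] le]]].
by exists f => //; rewrite -ltnS; apply: leq_trans (line_degree fX fxy) le.
Qed.

(** For maximum degree at most 4 the edges at a vertex of degree at most 2 have
at most max_degree neighbours in the line graph.  For larger maximum degree an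
edge with degree sum at most 6 has at most 4, and an edge at a vertex of degree 1 has
at most max_degree - 1. *)
Lemma chi_gl'_no_minors (G : sgraph) : no_K4 (@sadj G) -> no_K23 (@sadj G) ->
  (max_degree G < 5 -> chi_gl' G <= max_degree G + 1)%N /\
  (5 <= max_degree G -> chi_gl' G <= max_degree G)%N.
Proof.
move=> K4 K23.
have ex (X : {set edge G}) : X != finset.set0 -> exists x y, spanned X x y.
  by move=> /finset.set0Pn[f fX]; have [x [y [_ fxy]]] := edge_ends f;
    exists x, y; apply/existsP; exists f; rewrite fX fxy eqxx.
split=> D5; apply: chi_gl'_le => X /ex[a [b ab]].
  have [v [x [y [S [vx _ N _ _]]]]] := low_degree_vertex (@spanned_sym _ X) (@spanned_irr _ X)
    (no_K4_sub (@spanned_sub _ X) K4) ab.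
  exists v, x; split=> //; rewrite addn1 -add2n; apply: leq_add; last exact: spanned_degree.
  apply: leq_trans (subset_leq_card N) _; rewrite cards2; by case: (_ != _).
have [x [y [xy h]]] := light_edge (@spanned_sym _ X) (@spanned_irr _ X)
    (no_K4_sub (@spanned_sub _ X) K4) (no_K23_sub (@spanned_sub _ X) K23) ab.
exists x, y; split=> //; case: h => h; last exact: leq_trans h _.
by rewrite -add1n; apply: leq_add h (spanned_degree _ _).
Qed.
End GreedyColoring.

(** * Parity of crossings for chains of points in the plane *)

Section Crossing.
Variable R : realFieldType.
Local Open Scope ring_scope.
Notation pt := (R * R)%type.
Implicit Types (u p q x y : pt) (s t : seq pt).

(** The upper half plane with half of the horizontal axis, so that exactly one
of [u] and [- u] belongs to it when [u] is not zero. *)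
Definition upper u := (0 < u.2) || ((u.2 == 0) && (0 < u.1)).

(** Whether the short segment from [u] to [u'] crosses the half line of the
positive first coordinates. *)
Definition crosses u u' := (upper u (+) upper u') && (0 < u.1).

Definition nearby d p q := (`|p.1 - q.1| < d) && (`|p.2 - q.2| < d).

Definition pdiff q p : pt := (q.1 - p.1, q.2 - p.2).

(** Twice the step of the chains: a square of side less than [d] that avoids
a box of this size around the origin cannot cross both half axes. *)
Definition far d s t := forall p q, p \in s -> q \in t -> ~~ nearby (d *+ 2) p q.

Lemma upperN d p q : ~~ nearby (d *+ 2) p q -> 0 < d -> upper (pdiff q p) = ~~ upper (pdiff p q).
Proof.
rewrite /nearby /upper /pdiff /= => npq d0.
have ne : p.1 - q.1 = 0 -> p.2 - q.2 = 0 -> False.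
  by move=> h1 h2; move: npq; rewrite h1 h2 normr0 mulr2n addr_gt0.
rewrite -[q.2 - p.2]opprB -[q.1 - p.1]opprB !oppr_gt0 oppr_eq0.
have [h2|h2|h2] := ltgtP (p.2 - q.2) 0 => //=.
by have [h1|h1|h1] := ltgtP (p.1 - q.1) 0 => //; case: (ne h1 h2).
Qed.

(** Both vectors are then close to the horizontal axis and far from the origin,
hence on the same side of it. *)
Lemma opposite_halves d u u' : nearby (d *+ 2) u u' ->
  ~~ nearby (d *+ 2) u (0, 0) -> ~~ nearby (d *+ 2) u' (0, 0) ->
  upper u != upper u' -> (0 < u.1) = (0 < u'.1) /\ (u.1 != 0).
Proof.
case: u u' => [a b] [a' b']; rewrite /nearby /upper /= !subr0 mulr2n => /andP[na nb].
move=> f f' hh.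
have [b0 b0'] : `|b| < d + d /\ `|b'| < d + d.
  move: nb hh; have [hb|hb|hb] := ltgtP b 0; have [hb'|hb'|hb'] := ltgtP b' 0 => //= nb _;
  move: nb; rewrite !ltr_norml => /andP[? ?]; split; apply/andP; split; lra.
rewrite b0 andbT -leNgt in f; rewrite b0' andbT -leNgt in f'.
move: f f' na; rewrite ltr_norml => f f' /andP[? ?].
split; last by apply: contraTneq f => ->; rewrite normr0 -ltNge; move: b0; have := normr_ge0 b; lra.
apply/idP/idP => h; rewrite ltNge; apply/negP => h'.
  by rewrite (gtr0_norm h) in f; rewrite (ler0_norm h') in f'; lra.
by rewrite (gtr0_norm h) in f'; rewrite (ler0_norm h') in f; lra.
Qed.

Lemma nearby_tri d x y z : nearby d x y -> nearby d y z -> nearby (d *+ 2) x z.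
Proof.
rewrite /nearby mulr2n !ltr_norml => /andP[/andP[? ?] /andP[? ?]] /andP[/andP[? ?] /andP[? ?]].
by apply/andP; split; apply/andP; split; lra.
Qed.

Lemma nearbyW d x y : nearby d x y -> nearby (d *+ 2) x y.
Proof.
move=> h; apply: (nearby_tri h); rewrite /nearby !subrr normr0.
by case/andP: h => h _; rewrite (le_lt_trans (normr_ge0 _) h).
Qed.

Lemma nearbyC d x y : nearby d x y = nearby d y x.
Proof. by rewrite /nearby -normrN opprB -[`|x.2 - _|]normrN opprB. Qed.

(** The boundary of a small square meets the half line an even number of times. *)
Lemma crosses_square d u00 u01 u10 u11 :
  nearby d u00 u01 -> nearby d u10 u11 -> nearby d u00 u10 -> nearby d u01 u11 ->
  {in [:: u00; u01; u10; u11], forall u, ~~ nearby (d *+ 2) u (0, 0)} ->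
  crosses u00 u01 (+) crosses u10 u11 (+) crosses u00 u10 (+) crosses u01 u11 = false.
Proof.
move=> n1 n2 n3 n4 f.
have [f00 f01 f10 f11] : [/\ ~~ nearby (d *+ 2) u00 (0, 0), ~~ nearby (d *+ 2) u01 (0, 0),
  ~~ nearby (d *+ 2) u10 (0, 0) & ~~ nearby (d *+ 2) u11 (0, 0)].
  by split; apply: f; rewrite !inE eqxx ?orbT.
have S u u' : nearby (d *+ 2) u u' -> ~~ nearby (d *+ 2) u (0, 0) -> ~~ nearby (d *+ 2) u' (0,0) ->
    (upper u == upper u') || ((0 < u.1) == (0 < u'.1)).
  by move=> h h1 h2; case: eqVneq => //= /(opposite_halves h h1 h2)[-> _].
have := S _ _ (nearbyW n1) f00 f01; have := S _ _ (nearbyW n2) f10 f11.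
have := S _ _ (nearbyW n3) f00 f10; have := S _ _ (nearbyW n4) f01 f11.
have := S _ _ (nearby_tri n1 n4) f00 f11.
have n3' : nearby d u10 u00 by rewrite nearbyC.
have := S _ _ (nearby_tri n3' n1) f10 f01.
rewrite /crosses; move: (upper u00) (upper u01) (upper u10) (upper u11).
move: (0 < u00.1) (0 < u01.1) (0 < u10.1) (0 < u11.1).
by do 8!case.
Qed.

Fixpoint turns (g : pt -> pt) p s :=
  if s is q :: s' then crosses (g p) (g q) (+) turns g q s' else false.

(** Parity of the number of crossings of the chain [x :: s] with the horizontal
half line that starts at [p] and goes to the right. *)
Definition winding p x s := turns (fun y => pdiff y p) x s.

Lemma nearby_pdiff d x y p : nearby d (pdiff x p) (pdiff y p) = nearby d x y.
Proof. by rewrite /nearby /pdiff /= !opprB !addrA !subrK. Qed.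

Lemma nearby_pdiff2 d x y p : nearby d (pdiff p x) (pdiff p y) = nearby d x y.
Proof.
rewrite nearbyC /nearby /pdiff /= !opprB ![_ + (_ - p.1)]addrC ![_ + (_ - p.2)]addrC !addrA.
by rewrite !subrK.
Qed.

Lemma nearby_pdiff0 d x p : nearby d (pdiff x p) (0, 0) = nearby d x p.
Proof. by rewrite /nearby /pdiff /= !subr0. Qed.

(** Small squares are added up along the chain [y :: t]. *)
Lemma winding_strip d x x' y t : nearby d x x' -> path (nearby d) y t ->
  far d [:: x; x'] (y :: t) ->
  winding x y t (+) winding x' y t =
  crosses (pdiff y x) (pdiff y x') (+) crosses (pdiff (last y t) x) (pdiff (last y t) x').
Proof.
move=> xx'; elim: t y => [|y' t IH] y /=; first by rewrite addbb.
move=> /andP[yy' pt] f; rewrite /winding /=.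
have ft : far d [:: x; x'] (y' :: t) by move=> p q px qt; apply: f; rewrite // inE qt orbT.
have := IH y' pt ft; rewrite /winding => E.
have := @crosses_square d (pdiff y x) (pdiff y' x) (pdiff y x') (pdiff y' x').
rewrite !nearby_pdiff !nearby_pdiff2 => /(_ yy' yy' xx' xx') H.
move: E H; set A := turns _ _ _; set B := turns _ _ _ => E H.
have {}H := H _; rewrite addbACA E; move: H.
have F u : u \in [:: pdiff y x; pdiff y' x; pdiff y x'; pdiff y' x'] -> ~~ nearby (d *+ 2) u (0, 0).
  by rewrite !inE => /or4P[]/eqP->; rewrite nearby_pdiff0 nearbyC f // !inE eqxx ?orbT.
move=> /(_ F); do 4!case: (crosses _ _) => //=; by case: (crosses _ _).
Qed.

(** As x and y run over the two chains, y - x describes a rectangle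
that avoids the origin; its boundary crosses the half line an even number of
times. *)
Lemma turns_rectangle d x s y t : path (nearby d) x s -> path (nearby d) y t ->
  far d (x :: s) (y :: t) ->
  winding x y t (+) winding (last x s) y t =
  turns (pdiff y) x s (+) turns (pdiff (last y t)) x s.
Proof.
move=> + yt; elim: s x => [|x' s IH] x /=; first by rewrite addbb.
move=> /andP[xx' ps] f.
have f' : far d (x' :: s) (y :: t) by move=> p q px qt; apply: f; rewrite // inE px orbT.
have f2 : far d [:: x; x'] (y :: t).
  move=> p q px qt; apply: f => //; move: px; rewrite !inE => /orP[]->; by rewrite ?orbT.
have := IH x' ps f'; have := winding_strip xx' yt f2.
move: (winding _ _ _) (winding _ _ _) (winding _ _ _).
move: (turns _ _ _) (turns _ _ _) (crosses _ _) (crosses _ _).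
by do 7!case.
Qed.

(** Moving the subtrahend instead of the minuend amounts to counting the
crossings with the opposite half line.  Together the two half lines form the
horizontal axis, whose crossings are detected by the end points. *)
Lemma turns_flip d x s y : 0 < d -> path (nearby d) x s -> far d (x :: s) [:: y] ->
  turns (pdiff y) x s = winding y x s (+) upper (pdiff x y) (+) upper (pdiff (last x s) y).
Proof.
move=> d0; elim: s x => [|x' s IH] x /=; first by rewrite addbb.
move=> /andP[xx' ps] f.
have f' : far d (x' :: s) [:: y] by move=> p q px qt; apply: f; rewrite // inE px orbT.
have fx : ~~ nearby (d *+ 2) x y by apply: f; rewrite !inE eqxx.
have fx' : ~~ nearby (d *+ 2) x' y by apply: f; rewrite !inE eqxx ?orbT.
rewrite /winding /= (IH x' ps f') /winding.
have -> : crosses (pdiff y x) (pdiff y x') =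
    crosses (pdiff x y) (pdiff x' y) (+) upper (pdiff x y) (+) upper (pdiff x' y).
  rewrite /crosses (upperN fx d0) (upperN fx' d0).
  have := @opposite_halves d (pdiff x y) (pdiff x' y); rewrite nearby_pdiff !nearby_pdiff0 fx fx'.
  move=> /(_ (nearbyW xx') isT isT).
  case: (upper (pdiff x y)); case: (upper (pdiff x' y)) => //= /(_ isT)[_].
    by rewrite /= -[x.1 - y.1]opprB oppr_eq0 oppr_gt0; case: ltgtP.
  by rewrite /= -[x.1 - y.1]opprB oppr_eq0 oppr_gt0; case: ltgtP.
move: (crosses _ _) (turns _ _ _) (upper _) (upper _) (upper _); by do 5!case.
Qed.

Definition chain d x y s := path (nearby d) x s && (last x s == y).

(** The relation that two chains ab and ce far from each other impose on the
four winding parities of one chain around an end of the other. *)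
Lemma crossing_cell d a b s c e t : 0 < d -> chain d a b s -> chain d c e t ->
  far d (a :: s) (c :: t) ->
  winding a c t (+) winding b c t (+) winding c a s (+) winding e a s (+)
  upper (pdiff a c) (+) upper (pdiff b c) (+) upper (pdiff a e) (+) upper (pdiff b e) = false.
Proof.
move=> d0 /andP[ps /eqP<-] /andP[pt /eqP<-] f.
have := turns_rectangle ps pt f; rewrite !(turns_flip d0 ps).
- move: (winding _ _ _) (winding _ _ _) (winding _ _ _) (winding _ _ _).
  by move: (upper _) (upper _) (upper _) (upper _); do 8!case.
- by move=> p q px; rewrite inE => /eqP->; apply: f; rewrite ?mem_last.
- by move=> p q px; rewrite inE => /eqP->; apply: f; rewrite ?inE ?eqxx.
Qed.

Definition xor_all (K : eqType) (v : K -> bool) (ks : seq K) := \big[addb/false]_(k <- ks) v k.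

Lemma xor_all_odd (K : eqType) (v : K -> bool) (ks : seq K) :
  xor_all v ks = xor_all v [seq k <- undup ks | odd (count_mem k ks)].
Proof.
rewrite /xor_all -big_undup_iterop_count big_filter [RHS]big_mkcond; apply: eq_bigr => k _.
elim: (count_mem k ks) => [//|n IH]; rewrite Monoid.iteropE iterS -Monoid.iteropE IH /=.
by case: (odd n); case: (v k).
Qed.

(** The terms of [crossing_cell] as formal symbols, for the edges ab and ce of an
abstract graph: [[:: i; j; k]] stands for the winding of the edge jk around
[i], [[:: i; j]] with i < j for the position of [i] relative to [j], and [[::]]
for the constant true, which accounts for the exchange of [i] and [j]. *)
Definition atoms (q : nat * nat * nat * nat) : seq (seq nat) :=
  let: (a, b, c, e) := q in
  let h i j : seq (seq nat) := if (i < j)%N then [:: [:: i; j]] else [:: [::]; [:: j; i]] in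
  [:: [:: a; c; e]; [:: b; c; e]; [:: c; a; b]; [:: e; a; b]] ++
  h a c ++ h b c ++ h a e ++ h b e.

Definition odd_cells cells :=
  let s := flatten (map atoms cells) in [seq x <- undup s | odd (count_mem x s)].

(** The sum of the relations of [crossing_cell] over all pairs in [cells] says
that the symbols occurring an odd number of times add up to zero.  This is
absurd when the only such symbol is the constant true. *)
Lemma parity_obstruction (d : R) (p : nat -> pt) (s : nat -> nat -> seq pt)
    (cells : seq (nat * nat * nat * nat)) : 0 < d ->
  {in cells, forall ed, let: (a, b, c, e) := ed in
    [/\ chain d (p a) (p b) (s a b), chain d (p c) (p e) (s c e)
      & far d (p a :: s a b) (p c :: s c e)]} ->
  odd_cells cells != [:: [::]].
Proof.
move=> d0 hc; apply/eqP => odd1.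
pose v (k : seq nat) := match k with
  | [:: i; j] => upper (pdiff (p i) (p j))
  | [:: i; j; k] => winding (p i) (p j) (s j k)
  | _ => true end.
suff : xor_all v (flatten (map atoms cells)) = false.
  by rewrite xor_all_odd -/(odd_cells cells) odd1 /xor_all big_seq1.
elim: cells hc {odd1} => [|[[[a b] c] e] cells IH] hc; first by rewrite /xor_all big_nil.
rewrite -[flatten _]/(atoms (a, b, c, e) ++ flatten (map atoms cells)).
rewrite /xor_all big_cat -!/(xor_all v _) [LHS]/=.
rewrite IH => [|ed edc]; last by apply: hc; rewrite inE edc orbT.
have [h1 h2 f] := hc (a, b, c, e) (mem_head _ _).
have := crossing_cell d0 h1 h2 f; have [/andP[_ /eqP lb] /andP[_ /eqP le]] := (h1, h2).
have U i j : i != j -> ~~ nearby (d *+ 2) (p i) (p j) ->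
    xor_all v (if (i < j)%N then [:: [:: i; j]] else [:: [::]; [:: j; i]]) =
    upper (pdiff (p i) (p j)).
  move=> ij nij; case: ifP => _; rewrite /xor_all !big_cons big_nil /= addbF //.
  by rewrite (upperN nij d0); case: (upper _).
have V i j : p i \in p a :: s a b -> p j \in p c :: s c e ->
    xor_all v (if (i < j)%N then [:: [:: i; j]] else [:: [::]; [:: j; i]]) =
    upper (pdiff (p i) (p j)).
  move=> pi pj; have nij := f _ _ pi pj; apply: U => //; apply: contraNneq nij => ->.
  by rewrite /nearby !subrr normr0 mulr2n addr_gt0.
have pb : p b \in p a :: s a b by rewrite -lb mem_last.
have pe : p e \in p c :: s c e by rewrite -le mem_last.
move=> C; rewrite /xor_all /= !big_cons !big_cat /= -!/(xor_all v _) !V ?mem_head // -[RHS]C /= addbF.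
by rewrite !addbA.
Qed.

(** The unordered pairs of disjoint edges of the complete graph on 0, ..., 4.
For a vertex i and an edge jk not containing it there are two edges at i
disjoint from jk, so all winding terms cancel in the sum. *)
Definition K5_cells : seq (nat * nat * nat * nat) :=
  [:: (0,1,2,3); (0,2,1,3); (0,3,1,2);
      (4,0,1,2); (4,0,1,3); (4,0,2,3);
      (4,1,0,2); (4,1,0,3); (4,1,2,3);
      (4,2,0,1); (4,2,0,3); (4,2,1,3);
      (4,3,0,1); (4,3,0,2); (4,3,1,2)]%N.

(** The unordered pairs of disjoint edges of the complete bipartite graph with
parts 0, 1, 2 and 3, 4, 5. *)
Definition K33_cells : seq (nat * nat * nat * nat) :=
  [seq (ab.1, ij.1, ab.2, ij.2) | ab <- [:: (0, 1); (2, 0); (2, 1)],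
     ij <- [:: (3, 4); (3, 5); (4, 3); (4, 5); (5, 3); (5, 4)]]%N.

Lemma K5_odd : odd_cells K5_cells = [:: [::]].
Proof. by vm_compute. Qed.
Lemma K33_odd : odd_cells K33_cells = [:: [::]].
Proof. by vm_compute. Qed.

End Crossing.

(** * Discrete drawings with an apex *)

(** A drawing of the graph [e] by chains of points together with chains from a
further point [w] to all vertices, such that chains of edges without a common
end are far apart.  No condition is imposed on edges with a common end. *)
Section Walks.
Variables (R : realFieldType) (T : finType) (e : rel T) (d : R).
Notation pt := (R * R)%type.
Implicit Types (S : {set T}) (s : seq pt).
Variables (P : T -> pt) (l : T -> T -> seq pt) (w : pt) (k : T -> seq pt).
Hypotheses (d0 : (0 < d)%R)
  (hl : forall x y, e x y -> chain d (P x) (P y) (l x y))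
  (hk : forall x, chain d w (P x) (k x))
  (fl : forall x y x' y', e x y -> e x' y' -> [disjoint [set x; y] & [set x'; y']] ->
     far d (P x :: l x y) (P x' :: l x' y'))
  (fk : forall z x y, e x y -> z \notin [set x; y] -> far d (w :: k z) (P x :: l x y)).

Definition tube (S : {set T}) p :=
  exists x y, [/\ x \in S, y \in S, e x y & p \in P x :: l x y].

Definition in_tube S (s : seq pt) := forall p, p \in s -> tube S p.

Lemma linked_chain S a b : linked e S a b -> a != b ->
  exists s, chain d (P a) (P b) s /\ in_tube S (P a :: s).
Proof.
move=> /andP[aS /connectP[p pp ->]] ab.
have [z [zS az]] : exists z, z \in S /\ e a z.
  case: p pp ab => [|z p] /=; first by rewrite eqxx.
  by move=> /andP[/and3P[_ zS az] _] _; exists z.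
suff [s [cs ts]] : exists s, chain d (P a) (P (last a p)) s /\ in_tube S s.
  exists s; split=> // q; rewrite inE => /predU1P[->|/ts //].
  by exists a, z; split=> //; rewrite mem_head.
elim: p a aS pp {ab z zS az} => [|z p IH] a aS /=.
  by exists [::]; split=> //; rewrite /chain /= eqxx.
move=> /andP[/and3P[_ zS az] /(IH z zS)[s [/andP[ps /eqP ls] ts]]].
have /andP[pl /eqP ll] := hl az.
exists (l a z ++ s); split; first by rewrite /chain cat_path last_cat pl ll ps ls eqxx.
move=> q; rewrite mem_cat => /orP[ql|/ts//].
by exists a, z; split=> //; rewrite inE ql orbT.
Qed.

Lemma far_tubes S S' s s' : [disjoint S & S'] -> in_tube S s -> in_tube S' s' -> far d s s'.
Proof.
move=> dis ts ts' p q /ts[x [y [xS yS xy px]]] /ts'[x' [y' [xS' yS' xy' qx]]].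
apply: (fl xy xy' _ px qx); apply: disjointWl (disjointWr _ dis); apply/fintype.subsetP => z;
  by rewrite !inE => /orP[]/eqP->.
Qed.

Lemma far_apex S s z : z \notin S -> in_tube S s -> far d (w :: k z) s.
Proof.
move=> zS ts p q pk /ts[x [y [xS yS xy qx]]]; apply: (fk xy _ pk qx).
by apply: contra zS; rewrite !inE => /orP[]/eqP->.
Qed.

(** The four vertices and [w] would be a drawing of the complete graph on five
vertices. *)
Lemma drawn_no_K4 : no_K4 e.
Proof.
move=> x0 x1 x2 x3 [S01 [S23 [l01 l23 D1]]] [S02 [S13 [l02 l13 D2]]] [S03 [S12 [l03 l12 D3]]].
have [/andP[m01 m10] /andP[m23 m32]] := (linked_in l01, linked_in l23).
have [/andP[m02 m20] /andP[m13 m31]] := (linked_in l02, linked_in l13).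
have [/andP[m03 m30] /andP[m12 m21]] := (linked_in l03, linked_in l12).
have ne S S' x y : [disjoint S & S'] -> x \in S -> y \in S' -> x != y.
  by move=> dis xS; apply: contraTneq => <-; rewrite (disjointFr dis xS).
have [s01 [c01 t01]] := linked_chain l01 (ne _ _ _ _ D2 m02 m13).
have [s23 [c23 t23]] := linked_chain l23 (ne _ _ _ _ D2 m20 m31).
have [s02 [c02 t02]] := linked_chain l02 (ne _ _ _ _ D1 m01 m23).
have [s13 [c13 t13]] := linked_chain l13 (ne _ _ _ _ D1 m10 m32).
have [s03 [c03 t03]] := linked_chain l03 (ne _ _ _ _ D1 m01 m32).
have [s12 [c12 t12]] := linked_chain l12 (ne _ _ _ _ D1 m10 m23).
(* Index 4 exceeds the list, so that the default value [w] is the fifth vertex. *)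
pose p (i : nat) := nth w [:: P x0; P x1; P x2; P x3] i.
pose s (i j : nat) := match i, j with
  | 0, 1 => s01 | 2, 3 => s23 | 0, 2 => s02 | 1, 3 => s13 | 0, 3 => s03 | 1, 2 => s12
  | _, _ => k (nth x0 [:: x0; x1; x2; x3] j) end.
suff : odd_cells K5_cells != [:: [::]] by rewrite K5_odd eqxx.
apply: (@parity_obstruction _ d p s) => // ed.
have far_sym S S' : [disjoint S & S'] -> [disjoint S' & S] by rewrite disjoint_sym.
have out S S' x : [disjoint S & S'] -> x \in S -> x \notin S'.
  by move=> dis xS; rewrite (disjointFr dis xS).
rewrite /K5_cells !inE; do 14?case/orP; move=> /eqP->; rewrite /p /s /=; split=> //.
- exact: far_tubes D1 t01 t23.
- exact: far_tubes D2 t02 t13.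
- exact: far_tubes D3 t03 t12.
all: apply: far_apex; last eassumption.
all: first [by apply: (out _ _ _ D1) | by apply: (out _ _ _ (far_sym _ _ D1))
  | by apply: (out _ _ _ D2) | by apply: (out _ _ _ (far_sym _ _ D2))
  | by apply: (out _ _ _ D3) | by apply: (out _ _ _ (far_sym _ _ D3))].
Qed.

(** The two vertices, the point [w] and the three middle vertices would be a
drawing of the complete bipartite graph with two parts of size three. *)
Lemma drawn_no_K23 : no_K23 e.
Proof.
move=> v x m A B lA lB D.
have mem i : [/\ v \in A i, m i \in A i, x \in B i & m i \in B i].
  by have [/andP[-> ->] /andP[-> ->]] := (linked_in (lA i), linked_in (lB i)).
have ex_ne (i : 'I_3) : exists j, j != i.
  by have [->|i0] := eqVneq i ord0; [exists ord_max|exists ord0; rewrite eq_sym].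
have out i j y : i != j -> y \in A i -> y \notin B j by move=> /D ij yA; rewrite (disjointFr ij yA).
have vm i : v != m i.
  have [j ji] := ex_ne i; have [vA _ _ _] := mem j; have [_ _ _ mB] := mem i.
  by apply: contraNneq (out _ _ _ ji vA) => ->.
have xm i : x != m i.
  have [j ji] := ex_ne i; have [_ mA _ _] := mem i; have [_ _ xB _] := mem j.
  by rewrite eq_sym in ji; apply: contraNneq (out _ _ _ ji mA) => <-.
have [sA hA] := fin_all_exists (fun i => linked_chain (lA i) (vm i)).
have [sB hB] := fin_all_exists (fun i => linked_chain (lB i) (xm i)).
(* Indices 0, 1 and 2 are [v], [x] and the apex [w]; the middle vertices start at 3. *)
pose p (i : nat) := if i is i'.+3 then P (m (inord i')) else nth w [:: P v; P x] i.
pose s (i j : nat) := let t : 'I_3 := inord (j - 3) in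
  match i with 0 => sA t | 1 => sB t | _ => k (m t) end.
suff : odd_cells K33_cells != [:: [::]] by rewrite K33_odd eqxx.
apply: (@parity_obstruction _ d p s) => // ed /allpairsP[[ab ij] /= [hab hij ->]].
have [i [j [nij ->]]] : exists i j : 'I_3, i != j /\ ij = (i.+3, j.+3).
  have W a b : a < 3 -> b < 3 -> a != b -> ij = (a.+3, b.+3) ->
      exists i j : 'I_3, i != j /\ ij = (i.+3, j.+3).
    by move=> ha hb nab ->; exists (Ordinal ha), (Ordinal hb).
  move: hij; rewrite !inE; do 5?case/orP; move=> /eqP E.
  - exact: (W 0 1).
  - exact: (W 0 2).
  - exact: (W 1 0).
  - exact: (W 1 2).
  - exact: (W 2 0).
  - exact: (W 2 1).
have [ca ta] := hA i; have [cb tb] := hB j; have [ca' ta'] := hA j.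
have [vA miA _ _] := mem i; have [_ _ xB mjB] := mem j; have [_ _ _ miB] := mem i.
have [_ mjA _ _] := mem j.
have nji : j != i by rewrite eq_sym.
have sub3 n : n.+3 - 3 = n by rewrite -addn3 addnK.
move: hab; rewrite !inE => /or3P[]/eqP-> /=; rewrite /p /s !sub3 !inord_val.
- by split=> //; apply: far_tubes (D _ _ nij) ta tb.
- by split=> //; apply: far_apex ta'; apply: contraL miB; apply: out.
- by split=> //; apply: far_apex tb; apply: out nij miA.
Qed.

End Walks.

(** * From outerplanar drawings to chains of points *)

Section Topology.
Variable R : realType.
Local Open Scope classical_set_scope.
Local Open Scope ring_scope.
Notation pt := (R * R)%type.

Lemma nearbyP (d : R) (p q : pt) : reflect (ball p d q) (nearby d p q).
Proof. exact: andP. Qed.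

(** The points reachable by chains form a relatively open and closed subset,
since within [A] a ball of radius [d] around a reachable point contains
only reachable points. *)
Lemma connected_chain (A : set pt) (d : R) x y : connected A -> 0 < d -> A x -> A y ->
  exists s, chain d x y s /\ forall p, p \in s -> A p.
Proof.
move=> cA d0 Ax Ay.
pose reach z := exists s, chain d x z s /\ forall p, p \in s -> A p.
have step a b : reach a -> A b -> nearby d a b -> reach b.
  move=> [s [/andP[ps /eqP ls] As]] Ab ab; exists (rcons s b); split.
    by rewrite /chain rcons_path last_rcons ps ls ab eqxx.
  by move=> p; rewrite mem_rcons inE => /predU1P[->//|/As].
suff E : A `&` [set z | reach z] = A by have [_] : (A `&` [set z | reach z]) y by rewrite E.
apply: cA.
- have rx : reach x by exists [::]; rewrite /chain /= eqxx.
  by exists x.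
- exists (\bigcup_(a in A `&` [set z | reach z]) ball a d).
    by apply: bigcup_open => a _; apply: ball_open.
  apply/seteqP; split=> z [Az]; first by move=> rz; split=> //; exists z => //; exact: ballxx.
  by move=> [a [_ ra] az]; split=> //; apply: step ra Az _; apply/nearbyP.
(* Relatively closed: remove the balls around unreachable points. *)
- exists (~` \bigcup_(a in A `&` [set z | ~ reach z]) ball a d).
    by rewrite closedC; apply: bigcup_open => a _; apply: ball_open.
  apply/seteqP; split=> z [Az].
    move=> rz; split=> // -[a [Aa na] az]; apply: na; apply: step rz Aa _.
    by rewrite nearbyC; apply/nearbyP.
  move=> nz; split=> //; apply: contrapT => rz; apply: nz; exists z => //; exact: ballxx.
Qed.

(** A point of [K] has a ball free of [K']; half the radius works for
the nearby points of [K], and finitely many such balls suffice. *)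
Lemma compact_far (K K' : set pt) : compact K -> compact K' -> K `&` K' = set0 ->
  \forall d \near (0:R)^'+, forall p q, K p -> K' q -> ~~ nearby (d *+ 2) p q.
Proof.
move=> cK cK' KK'.
have clK' : closed K' by apply: compact_closed cK'; exact: norm_hausdorff.
suff : \forall d \near (0:R)^'+, K `<=` (fun p => forall q, K' q -> ~~ nearby (d *+ 2) p q).
  by apply: filterS => d h p q Kp K'q; exact: h.
apply: (iffLR (compact_near_coveringP K) cK) => p Kp.
have : nbhs p (~` K').
  apply: open_nbhs_nbhs; split; first exact: closed_openC.
  by move=> K'p; have : (K `&` K') p by []; rewrite KK'.
move=> /nbhs_ballP[r /= r0 pr].
(* Distances up to twice [d] are to be excluded, whence a quarter of the radius. *)
exists (ball p (r / 2), [set d | d < r / 4]).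
  split => /=; first by apply: nbhsx_ballx; rewrite divr_gt0.
  by apply: nbhs_right_lt; rewrite divr_gt0.
move=> [p' d] /= [[pp1 pp2] dr] q K'q; apply/negP => /nearbyP[pq1 pq2].
have {}dr : d < r / 4 := dr.
apply: (pr q) => //; split.
- apply: le_ball (ball_triangle pp1 pq1); lra.
- apply: le_ball (ball_triangle pp2 pq2); lra.
Qed.

Definition seg (a b : pt) : set pt := (fun t : R => a + t *: (b - a)) @` `[0, 1].

Lemma seg_cont (a b : pt) : {within `[0, 1], continuous (fun t : R => a + t *: (b - a))}.
Proof.
apply: continuous_subspaceT => t; apply: cvgD; first exact: cvg_cst.
by apply: cvgZr_tmp; exact: cvg_id.
Qed.

Lemma seg_compact a b : compact (seg a b).
Proof. by apply: continuous_compact; [exact: seg_cont|exact: segment_compact]. Qed.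

Lemma seg_connected a b : connected (seg a b).
Proof. by apply: connected_continuous_connected; [exact: segment_connected|exact: seg_cont]. Qed.

Lemma seg_l a b : seg a b a.
Proof. by exists 0; rewrite /= ?in_itv /= ?lexx ?ler01 // scale0r addr0. Qed.

Lemma seg_r a b : seg a b b.
Proof. by exists 1; rewrite /= ?in_itv /= ?lexx ?ler01 // scale1r addrC subrK. Qed.

Lemma seg_ball a b r : ball a r b -> seg a b `<=` ball a r.
Proof.
have aux (u v t : R) : 0 <= t <= 1 -> `|u - v| < r -> `|u - (u + t * (v - u))| < r.
  move=> /andP[t0 t1] uv; rewrite opprD addNKr normrN normrM (ger0_norm t0) distrC.
  by apply: le_lt_trans uv; rewrite ler_piMl.
by move=> [h1 h2] _ [t /= + <-]; rewrite in_itv => t01; split; apply: aux.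
Qed.

(** A substitute for the existence of a path in [U] from [a] to [b]: compactness
keeps the connection at positive distance from the complement of [U],
connectedness provides chains of any step. *)
Definition joined (U : set pt) a b :=
  exists C : set pt, [/\ compact C, connected C, C `<=` U, C a & C b].

Lemma joined_trans U a b c : joined U a b -> joined U b c -> joined U a c.
Proof.
move=> [C [kC cC CU Ca Cb]] [D [kD cD DU Db Dc]]; exists (C `|` D); split.
- exact: compactU.
- by apply: connectedU => //; exists b.
- by move=> x [/CU|/DU].
- by left.
- by right.
Qed.

Lemma joined_seg U a b r : ball a r `<=` U -> ball a r b -> joined U a b.
Proof.
move=> aU ab; exists (seg a b); split.
- exact: seg_compact.
- exact: seg_connected.
- exact: subset_trans (seg_ball ab) aU.
- exact: seg_l.
- exact: seg_r.
Qed.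

Lemma joined_sym U a b : joined U a b -> joined U b a.
Proof. by move=> [C [? ? ? ? ?]]; exists C. Qed.

(** The points joined to [a] form an open set, and so do the points of [U] not
joined to it, because small balls in [U] are joined to their centre. *)
Lemma connected_joined (U F : set pt) a b : open U -> connected F -> F `<=` U ->
  F a -> F b -> joined U a b.
Proof.
move=> oU cF FU Fa Fb.
have rad x : U x -> exists2 r : R, 0 < r & ball x r `<=` U.
  move=> Ux; have /nbhs_ballP[r r0 h] : nbhs x U by exact: open_nbhs_nbhs.
  by exists r.
have oB : open [set x | joined U a x].
  rewrite openE => x jx /=.
  have [r r0 xr] : exists2 r : R, 0 < r & ball x r `<=` U.
    by apply: rad; case: jx => C [_ _ CU _ /CU].
  apply/nbhs_ballP; exists r => //= y xy.
  exact: joined_trans jx (joined_seg xr xy).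
have oN : open [set x | U x /\ ~ joined U a x].
  rewrite openE => x [Ux jx] /=; have [r r0 xr] := rad x Ux.
  apply/nbhs_ballP; exists r => //= y xy; split; first exact: xr.
  by move=> jy; apply: jx; apply: joined_trans jy (joined_sym (joined_seg xr xy)).
suff E : F `&` [set x | joined U a x] = F.
  by have [_] : (F `&` [set x | joined U a x]) b by rewrite E.
apply: cF.
- exists a; split=> //=; have [r r0 ar] := rad a (FU _ Fa).
  by apply: joined_seg ar _; exact: ballxx.
- by exists [set x | joined U a x].
- exists (~` [set x | U x /\ ~ joined U a x]); first exact: open_closedC.
  apply/seteqP; split=> x [Fx] /=; first by move=> jx; split=> // -[].
  by move=> h; split=> //; apply: contrapT => jx; apply: h; split=> //; exact: FU.
Qed.

Section OfDrawing.
Variables (G : sgraph) (D : drawing R G).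

Definition trace (e : edge G) : set pt := Defs.arc D e @` `[0, 1].

Lemma trace_compact e : compact (trace e).
Proof. by apply: continuous_compact; [exact: arc_cont|exact: segment_compact]. Qed.

Lemma trace_connected e : connected (trace e).
Proof. by apply: connected_continuous_connected; [exact: segment_connected|exact: arc_cont]. Qed.

Lemma trace_case (e : edge G) p : trace e p ->
  (exists2 x, x \in val e & p = pos D x) \/ exists2 t, t \in `]0, 1[ & p = Defs.arc D e t.
Proof.
move=> [t /= + <-]; rewrite in_itv /= => /andP[t0 t1].
have E : [set Defs.arc D e 0; Defs.arc D e 1] `<=` [set p | exists2 x, x \in val e & p = pos D x].
  by rewrite arc_ends => _ [x /= xe <-]; exists x.
move: t0; rewrite le_eqVlt => /predU1P[<-|t0]; first by left; apply: E; left.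
move: t1; rewrite le_eqVlt => /predU1P[->|t1]; first by left; apply: E; right.
by right; exists t => //; rewrite in_itv /= t0 t1.
Qed.

Lemma trace_end (e : edge G) x : x \in val e -> trace e (pos D x).
Proof.
move=> xe; have : [set Defs.arc D e 0; Defs.arc D e 1] (pos D x) by rewrite arc_ends; exists x.
by case=> ->; [exists 0|exists 1]; rewrite //= in_itv /= lexx ler01.
Qed.

Lemma trace_vertex (e : edge G) x : trace e (pos D x) -> x \in val e.
Proof.
move=> /trace_case[[y ye /pos_inj->//]|[t t01 E]].
by case: (arc_vertex t01 (esym E)).
Qed.

Lemma trace_disjoint (e e' : edge G) : [disjoint val e & val e']%B -> trace e `&` trace e' = set0.
Proof.
move=> dis; apply/seteqP; split=> // p [pe pe'].
have [[x xe E]|[s s01 E]] := trace_case pe.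
  by move: pe'; rewrite E => /trace_vertex; rewrite (disjointFr dis xe).
have [[x xe' E']|[t t01 E']] := trace_case pe'.
  by move: pe; rewrite E' => /trace_vertex; rewrite (disjointFl dis xe').
have [x [y [_ exy]]] := edge_ends e.
have ee' : e != e'.
  have xe : x \in val e by rewrite exy set21.
  by apply/eqP => h; have := disjointFr dis xe; rewrite -h xe.
by case: (arc_disj ee' s01 t01 (etrans (esym E) E')).
Qed.

Lemma drawing_closed : closed (drawing_set D).
Proof.
have hR : hausdorff_space pt by exact: norm_hausdorff.
apply: closedU.
  rewrite [range _](_ : _ = \bigcup_(x in [set: G]) [set pos D x]); last first.
    by apply/seteqP; split=> [_ [x _ <-]|_ [x _ ->]]; exists x.
  apply: closed_bigcup => [|/=]; first exact: finite_finset.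
  by move=> x _; apply: compact_closed => //; exact: compact_set1.
apply: closed_bigcup => [|/=]; first exact: finite_finset.
  move=> e _; apply: compact_closed => //; exact: trace_compact.
Qed.

Definition traces x y : set pt := [set p | exists2 e, val e = [set x; y]%SET & trace e p].

Lemma tracesE (e : edge G) x y : val e = [set x; y]%SET -> traces x y = trace e.
Proof.
move=> exy; apply/seteqP; split=> [p [e' e'xy]|p pe]; last by exists e.
by rewrite (_ : e' = e) //; apply: val_inj; rewrite /= exy.
Qed.

Lemma adj_edge (x y : G) : sadj x y -> exists e : edge G, val e = [set x; y]%SET.
Proof.
move=> xy; have exy : [set x; y]%SET \in edges G.
  by rewrite inE; apply/existsP; exists x; apply/existsP; exists y; rewrite xy eqxx.
by exists (exist (fun e => e \in edges G) _ exy).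
Qed.

(** Each vertex is a limit of points of the face.  Inside the open complement of
the drawing such a point is joined to the base point [w] of the face; a short
segment then leads to the vertex and meets only arcs that end there. *)
Lemma apex (F : set pt) : outer_face D F -> (forall x, boundary F (pos D x)) ->
  exists w, forall x, exists A : set pt, [/\ compact A, connected A, A w, A (pos D x) &
    forall e : edge G, x \notin val e -> A `&` trace e = set0].
Proof.
move=> [w nw [FE _]] bF; exists w => x.
pose N := \bigcup_(e in [set e : edge G | x \notin val e]) trace e.
have cN : closed N.
  apply: closed_bigcup => [|/=]; first exact: finite_finset.
  move=> e _; apply: compact_closed; last exact: trace_compact.
  exact: norm_hausdorff.
have /nbhs_ballP[r /= r0 rN] : nbhs (pos D x) (~` N).
  apply: open_nbhs_nbhs; split; first exact: closed_openC.
  by move=> [e /= xe /trace_vertex]; rewrite (negPf xe).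
have [clF _] := bF x; have [y [Fy xy]] := clF _ (nbhsx_ballx (pos D x) r r0).
have oU : open (~` drawing_set D) by apply: closed_openC; exact: drawing_closed.
have Fw : F w by rewrite FE; exact: connected_component_refl.
have FU : F `<=` ~` drawing_set D by rewrite FE; exact: connected_component_sub.
have cF : connected F by rewrite FE; exact: component_connected.
have [C [kC cC CU Cw Cy]] := connected_joined oU cF FU Fw Fy.
exists (C `|` seg (pos D x) y); split.
- by apply: compactU => //; exact: seg_compact.
- apply: connectedU => //; last exact: seg_connected.
  by exists y; split=> //; exact: seg_r.
- by left.
- by right; exact: seg_l.
- move=> e xe; apply/seteqP; split=> // p [[Cp|sp] pe].
    by apply: (CU _ Cp); right; exists e.
  by apply: (rN p (seg_ball xy sp)); exists e.
Qed.

End OfDrawing.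

(** The finitely many pairs of disjoint compact sets involved are at a common
positive distance.  A step [d] is chosen below it, and each arc and each
connection to the outer face is replaced by a chain of points of step [d]. *)
Lemma outerplanar_no_minors (G : sgraph) : outerplanar R G ->
  no_K4 (@sadj G) /\ no_K23 (@sadj G).
Proof.
move=> [D [F [oF bF]]].
have [w /choice[A hA]] := apex oF bF.
have kA x : compact (A x) by have [] := hA x.
have farA : \forall d \near (0:R)^'+, forall (x : G) (e : edge G), x \notin val e ->
    forall p q, A x p -> trace D e q -> ~~ nearby (d *+ 2) p q.
  apply: filter_forall => x; apply: filter_forall => e.
  have [xe|xe] := boolP (x \in val e); first by apply: nearW => d /negP[].
  have [_ _ _ _ /(_ e xe) dis] := hA x.
  by have := compact_far (kA x) (@trace_compact _ D e) dis; apply: filterS => d h _.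
have farE : \forall d \near (0:R)^'+, forall (e e' : edge G), [disjoint val e & val e']%B ->
    forall p q, trace D e p -> trace D e' q -> ~~ nearby (d *+ 2) p q.
  apply: filter_forall => e; apply: filter_forall => e'.
  have [dis|ndis] := boolP [disjoint val e & val e']%B; last first.
    by apply: nearW => d h; case/negP: ndis.
  have := compact_far (@trace_compact _ D e) (@trace_compact _ D e') (trace_disjoint D dis).
  by apply: filterS => d h _.
have [d [d0 fA fE]] : exists d : R, [/\ 0 < d,
   forall (x : G) (e : edge G), x \notin val e ->
    forall p q, A x p -> trace D e q -> ~~ nearby (d *+ 2) p q
  & forall (e e' : edge G), [disjoint val e & val e']%B ->
    forall p q, trace D e p -> trace D e' q -> ~~ nearby (d *+ 2) p q].
  have : \forall d \near (0:R)^'+, 0 < d by exact: nbhs_right_gt.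
  by move=> h; have [d [d0 [h1 h2]]] := filter_ex (filterI h (filterI farA farE)); exists d.
have exk x : exists s, chain d w (pos D x) s /\ forall p, p \in s -> A x p.
  by have [_ cA Aw Ax _] := hA x; exact: connected_chain.
have exl (xy : G * G) : exists s, sadj xy.1 xy.2 -> chain d (pos D xy.1) (pos D xy.2) s /\
    forall p, p \in s -> traces D xy.1 xy.2 p.
  have [adj|nadj] := boolP (sadj xy.1 xy.2); last by exists [::].
  have [e exy] := adj_edge adj; rewrite (tracesE D exy).
  have [s hs] : exists s, chain d (pos D xy.1) (pos D xy.2) s /\ forall p, p \in s -> trace D e p.
    apply: connected_chain => //; first exact: trace_connected.
      by apply: trace_end; rewrite exy set21.
    by apply: trace_end; rewrite exy set22.
  by exists s.
have [k hk] := choice exk; have [l hl] := choice exl.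
have inl x y p : sadj x y -> p \in pos D x :: l (x, y) ->
    exists2 e, val e = [set x; y]%SET & trace D e p.
  move=> xy; rewrite inE => /predU1P[->|]; last by have [_] := hl (x, y) xy; apply.
  have [e exy] := adj_edge xy; exists e => //; by apply: trace_end; rewrite exy set21.
have hk' x : chain d w (pos D x) (k x) by have [] := hk x.
have hl' x y : sadj x y -> chain d (pos D x) (pos D y) (l (x, y)).
  by move=> xy; have [] := hl (x, y) xy.
have ll x y x' y' : sadj x y -> sadj x' y' -> [disjoint [set x; y]%SET & [set x'; y']%SET]%B ->
    far d (pos D x :: l (x, y)) (pos D x' :: l (x', y')).
  move=> xy xy' dis p q /(inl _ _ _ xy)[e exy pe] /(inl _ _ _ xy')[e' exy' qe].
  by apply: (fE e e') => //; rewrite exy exy'.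
have lk z x y : sadj x y -> z \notin [set x; y]%SET -> far d (w :: k z) (pos D x :: l (x, y)).
  move=> xy zxy p q pk /(inl _ _ _ xy)[e exy qe]; apply: (fA z e) => //; first by rewrite exy.
  move: pk; rewrite inE => /predU1P[->|]; last by have [_] := hk z; apply.
  by have [] := hA z.
split; [exact: (drawn_no_K4 (l := fun x y => l (x, y)) d0 hl' hk' ll lk)
       |exact: (drawn_no_K23 (l := fun x y => l (x, y)) d0 hl' hk' ll lk)].
Qed.

End Topology.

Theorem theorem4p2 (R : realType) (G : sgraph) (hG : outerplanar R G) :
  (max_degree G < 5 -> chi_gl' G <= max_degree G + 1)%N /\
  (5 <= max_degree G -> chi_gl' G <= max_degree G)%N.
Proof.
by have [K4 K23] := outerplanar_no_minors hG; exact: chi_gl'_no_minors.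
Qed.
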